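(* Let $\Pi$ be a uniformly random permutation of $\{1,\ldots,n\}$, let $N_n$ be the number of cycles of $\Pi$, and for integers $n,s\geq 1$ let $\mu_{n,s} = \mathbb{E} N_n^s$ (with $\mu_{0,s} := 0$). Then for all integers $n,s \geq 1$, \[ \mu_{n,s} = 1 + \frac{1}{n}\sum_{r=1}^{s}\sum_{j=1}^{n-1}\binom{s}{r}\mu_{j,r}. \]
   Context: A uniformly random permutation $\Pi$ of $\{1,\ldots,n\}$ satisfies $\mathbb{P}(\Pi = \pi) = 1/n!$ for every permutation $\pi$. A cycle of length $k$ of a permutation $\pi$ is a $k$-tuple $(i_1,\ldots,i_k)$ with $\pi(i_j) = i_{j+1}$ for $1\le j\le k-1$ and $\pi(i_k)=i_1$; every element lies in exactly one cycle. *)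

(* Defs.v *)
From HB Require Import structures.
From mathcomp Require Import all_boot all_order all_algebra all_fingroup.

Set Implicit Arguments.
Unset Strict Implicit.
Unset Printing Implicit Defensive.

Import Order.TTheory GRing.Theory Num.Theory.
Local Open Scope ring_scope.

(* The set {1, ..., n} is represented by 'I_n = {0, ..., n-1}. *)

(* [porbits p] is the set of orbits {i, p i, p (p i), ...} of p, i.e. the
   cycles up to the choice of their starting point; fixed points are included,
   as cycles of length 1. *)
Definition ncycles (n : nat) (p : 'S_n) : nat := #|porbits p|.

Definition uniform_perm (R : realFieldType) (n : nat) (p : 'S_n) : R :=
  (n`!%:R)^-1.

Definition expectation (R : realFieldType) (T : finType) (P X : T -> R) : R :=
  \sum_(t : T) P t * X t.

Definition mu (R : realFieldType) (n s : nat) : R :=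
  expectation (@uniform_perm R n) (fun p => (ncycles p)%:R ^+ s).

Lemma uniform_perm_sum1 (R : realFieldType) (n : nat) :
  \sum_(p : 'S_n) uniform_perm R p = 1.
Proof.
rewrite /uniform_perm sumr_const card_Sn -[_^-1 *+ _]mulr_natl divff //.
by rewrite pnatr_eq0 -lt0n fact_gt0.
Qed.

(* The unique permutation of the empty set has no cycle, so that the
   convention mu_{0,s} = 0 for s >= 1 holds without a special case. *)
Lemma mu0 (R : realFieldType) (s : nat) : (1 <= s)%N -> mu R 0 s = 0.
Proof.
move=> s_gt0; rewrite /mu /expectation big1 // => p _.
suff -> : ncycles p = 0%N by rewrite expr0n gtn_eqF // mulr0.
apply/eqP; rewrite cards_eq0; apply/set0Pn => -[A /imsetP[[]]] //.
Qed.

(* Main.v *)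
Require Import Defs.
From HB Require Import structures.
From mathcomp Require Import all_boot all_order all_algebra all_fingroup.

Import Order.TTheory GRing.Theory Num.Theory.
Local Open Scope ring_scope.

(** Write a permutation of n.+1 points uniquely as a transposition (0 i) times
    a permutation fixing 0. The latter is a permutation of n points with an
    extra fixed point, and multiplying by (0 i) merges this fixed point into
    another cycle unless i = 0. Hence
      (n+1) E f(N_{n+1}) = E f(N_n + 1) + n E f(N_n),
    so n E f(N_n) is the sum of E f(N_j + 1) over j < n; the theorem is the
    binomial expansion of f(N_j + 1) = (N_j + 1)^s. *)

Lemma lift_permX (n : nat) (i : 'I_n.+1) (q : 'S_n) (m : nat) :
  (lift_perm i i q ^+ m)%g = lift_perm i i (q ^+ m)%g.
Proof.
elim: m => [|m IHm]; first by rewrite !expg0 lift_perm1.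
by rewrite !expgS IHm lift_permM.
Qed.

Lemma porbit_lift_perm_id (n : nat) (i : 'I_n.+1) (q : 'S_n) :
  porbit (lift_perm i i q) i = [set i].
Proof.
apply/setP=> y; rewrite inE; apply/porbitP/eqP => [[m ->]|->].
  by rewrite lift_permX lift_perm_id.
by exists 0%N; rewrite expg0 perm1.
Qed.

Lemma porbit_lift_perm_lift (n : nat) (i : 'I_n.+1) (q : 'S_n) (k : 'I_n) :
  porbit (lift_perm i i q) (lift i k) = lift i @: porbit q k.
Proof.
apply/setP=> y; apply/porbitP/imsetP => [[m ->]|[z /porbitP[m ->] ->]].
  by exists ((q ^+ m)%g k); rewrite ?mem_porbit // lift_permX lift_perm_lift.
by exists m; rewrite lift_permX lift_perm_lift.
Qed.

(** The cycles avoiding [i] are the images under [lift i] of the cycles of [q]; the only other one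
    is the fixed point [i] itself. *)
Lemma ncycles_lift_perm (n : nat) (i : 'I_n.+1) (q : 'S_n) :
  ncycles (lift_perm i i q) = (ncycles q).+1.
Proof.
have -> : ncycles (lift_perm i i q)
    = #|[set i] |: [set lift i @: A | A : {set 'I_n} in porbits q]|.
  congr #|pred_of_set _|; apply/setP=> A; rewrite !inE.
  apply/imsetP/orP => [[y _ ->]|[/eqP->|/imsetP[_ /imsetP[k _ ->] ->]]].
  - case: (unliftP i y) => [k|] ->; last by left; rewrite porbit_lift_perm_id.
    by right; rewrite porbit_lift_perm_lift; do 2!apply: imset_f.
  - by exists i; rewrite ?porbit_lift_perm_id.
  - by exists (lift i k); rewrite ?porbit_lift_perm_lift.
rewrite cardsU1 card_imset; last exact/imset_inj/lift_inj.
(* The singleton is a new orbit: [i] is not in the range of [lift i]. *)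
case: imsetP => // -[A _ /setP/(_ i)]; rewrite set11 => /esym/imsetP[k _].
by move/eqP; rewrite (negPf (neq_lift i k)).
Qed.

Lemma ncycles_tperm_lift_perm (n : nat) (i j : 'I_n.+1) (q : 'S_n) :
  ncycles (tperm i j * lift_perm i i q)%g = (ncycles q + (i == j))%N.
Proof.
case: eqVneq => [<-|neq_ij].
  by rewrite tperm1 mul1g ncycles_lift_perm addn1.
(* For [j] distinct from the fixed point [i], the two lie in different cycles, so the transposition
   merges them and undoes the gain of one cycle. *)
have := porbits_mul_tperm (lift_perm i i q) i j.
rewrite porbit_sym porbit_lift_perm_id inE eq_sym neq_ij /=.
rewrite -!/(ncycles _) ncycles_lift_perm addn0 addn1 addn2.
by case.
Qed.

(** Injectivity suffices, since (n+1) n! = (n+1)!. *)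
Lemma tperm_lift_perm_bij (n : nat) (i : 'I_n.+1) :
  bijective (fun u : 'I_n.+1 * 'S_n => tperm i u.1 * lift_perm i i u.2)%g.
Proof.
apply: inj_card_bij => [[j q] [j' q'] /= eq_jq|]; last first.
  by rewrite card_prod !card_Sn card_ord factS.
(* Products act from left to right, so the product sends [j] to [i] and then fixes it: [j] is
   recovered as the preimage of [i]. *)
have eq_j : j = j'.
  apply: (@perm_inj _ (tperm i j * lift_perm i i q)%g).
  by rewrite {2}eq_jq !permM !tpermR !lift_perm_id.
rewrite -{}eq_j in eq_jq *; congr (_, _); apply/permP=> k.
move/mulgI/permP/(_ (lift i k)): eq_jq.
by rewrite !lift_perm_lift => /lift_inj.
Qed.

Lemma sum_ncycles_recr (R : pzRingType) (f : nat -> R) (n : nat) :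
  \sum_(p : 'S_n.+1) f (ncycles p)
    = \sum_(q : 'S_n) f (ncycles q).+1 + n%:R * \sum_(q : 'S_n) f (ncycles q).
Proof.
rewrite (reindex _ (onW_bij _ (tperm_lift_perm_bij n ord0))) /=.
rewrite -(pair_bigA _ (fun j q =>
  f (ncycles (tperm ord0 j * lift_perm ord0 ord0 q)%g))) /=.
rewrite big_ord_recl; congr (_ + _).
  by apply: eq_bigr => q _; rewrite ncycles_tperm_lift_perm eqxx addn1.
under eq_bigr do under eq_bigr do rewrite ncycles_tperm_lift_perm addn0.
by rewrite sumr_const card_ord mulr_natl.
Qed.

Section ExpectationNcycles.
Variable R : realFieldType.

(** Division of the recursion for sums by n!; the factor n+1 on the left comes from (n+1)! = (n+1)
    n!. *)
Lemma expectation_ncycles_recr (f : nat -> R) (n : nat) :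
  n.+1%:R * expectation (@uniform_perm R n.+1) (fun p => f (ncycles p))
    = expectation (@uniform_perm R n) (fun p => f (ncycles p).+1)
      + n%:R * expectation (@uniform_perm R n) (fun p => f (ncycles p)).
Proof.
rewrite /expectation /uniform_perm -!mulr_sumr sum_ncycles_recr factS natrM.
by rewrite invfM !mulrA divff ?pnatr_eq0 // mul1r mulrDr mulrA [_ * n%:R]mulrC.
Qed.

Lemma expectation_ncycles_sum (f : nat -> R) (n : nat) :
  n%:R * expectation (@uniform_perm R n) (fun p => f (ncycles p))
    = \sum_(j < n) expectation (@uniform_perm R j) (fun p => f (ncycles p).+1).
Proof.
elim: n => [|n IHn]; first by rewrite mul0r big_ord0.
by rewrite expectation_ncycles_recr big_ord_recr IHn addrC.
Qed.

Lemma mu_exp0 (n : nat) : mu R n 0 = 1.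
Proof.
rewrite -[RHS](uniform_perm_sum1 R n).
by apply: eq_bigr => p _; rewrite expr0 mulr1.
Qed.

Lemma expectation_ncyclesS_expr (n s : nat) :
  expectation (@uniform_perm R n) (fun p => (ncycles p).+1%:R ^+ s)
    = \sum_(r < s.+1) 'C(s, r)%:R * mu R n r.
Proof.
under [RHS]eq_bigr do rewrite /mu /expectation mulr_sumr.
rewrite exchange_big; apply: eq_bigr => p _ /=.
rewrite -natr1 addrC exprDn mulr_sumr; apply: eq_bigr => r _.
by rewrite expr1n mul1r -mulr_natl mulrCA.
Qed.

End ExpectationNcycles.

Theorem theorem3 (R : realFieldType) (n s : nat) (hn : (1 <= n)%N) (hs : (1 <= s)%N) :
  mu R n s =
    1 + (n%:R)^-1 *
      (\sum_(1 <= r < s.+1) \sum_(1 <= j < n) ('C(s, r))%:R * mu R j r).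
Proof.
have n_neq0 : n%:R != 0 :> R by rewrite pnatr_eq0 -lt0n.
apply: (mulfI n_neq0); rewrite mulrDr mulr1 mulVKf //.
rewrite /mu (expectation_ncycles_sum _ (fun k => k%:R ^+ s)).
under eq_bigr do rewrite expectation_ncyclesS_expr.
(* The term r = 0 is a sum of n ones, including j = 0, and matches the summand 1 of the claim
   multiplied by n. *)
rewrite exchange_big /= big_ord_recl /=; congr (_ + _).
  under eq_bigr do rewrite bin0 mul1r mu_exp0.
  by rewrite sumr_const card_ord.
rewrite big_add1 big_mkord; apply: eq_bigr => r _.
rewrite -(big_mkord xpredT (fun j => 'C(s, r.+1)%:R * mu R j r.+1)).
(* The sum may start at j = 1 because the exponent [r.+1] is positive, so that the term j = 0
   vanishes. *)
by rewrite big_ltn // mu0 // mulr0 add0r.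
Qed.
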